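(* Let $(X,d)$ be a u.l.f. metric space, $h\colon X\to\mathbb{R}$ a coarse map, and $\beta\in\mathbb{R}$. If $\varphi$ is a $(\sigma_h,\beta)$-KMS state on $\mathrm{C}^*_u(X)$, then $\varphi=\varphi\circ E$, where $E\colon\mathrm{C}^*_u(X)\to\ell_\infty(X)$ is the canonical conditional expectation.
   Context: A metric space is u.l.f. if for every $r>0$ the cardinalities of its balls of radius $r$ are uniformly bounded. With $(\delta_x)$ the canonical basis of $\ell_2(X)$ and $a_{x,y}=\langle a\delta_y,\delta_x\rangle$, the propagation of $a$ is $\sup\{d(x,y):a_{x,y}\neq0\}$; $\mathrm{C}^*_u[X]$ is the $^*$-algebra of finite-propagation operators and $\mathrm{C}^*_u(X)$ its norm closure. $h$ is coarse if for each $r>0$ there is $s>0$ with $d(x,y)<r\Rightarrow|h(x)-h(y)|<s$. $\sigma_h$ is the flow (strongly continuous one-parameter automorphism group) on $\mathrm{C}^*_u(X)$ given by $\sigma_{h,t}(a)=e^{it\bar h}ae^{-it\bar h}$, where $e^{it\bar h}\delta_x=e^{ith(x)}\delta_x$. An element $b$ is analytic if $t\mapsto\sigma_{h,t}(b)$ extends to an entire map $z\mapsto\sigma_{h,z}(b)$. A state $\varphi$ is a $(\sigma_h,\beta)$-KMS state if $\varphi(a\sigma_{h,i\beta}(b))=\varphi(ba)$ for all $a\in\mathrm{C}^*_u(X)$ and all analytic $b$. $\ell_\infty(X)$ is identified with the diagonal operators on $\ell_2(X)$, and $E$ sends $a$ to the diagonal operator with entries $a_{x,x}$. *)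

(* Defs.v *)
From HB Require Import structures.
From mathcomp Require Import all_boot all_order all_algebra finmap.
From mathcomp Require Import complex.
From mathcomp Require Import boolp classical_sets reals trigo.

Set Implicit Arguments.
Unset Strict Implicit.
Unset Printing Implicit Defensive.

Import Order.TTheory GRing.Theory Num.Theory.
Local Open Scope ring_scope.
Local Open Scope complex_scope.

Section Roe.
Variable R : realType.
Variable X : choiceType.

(* Operators on l2(X) are represented by their matrices a x y = <a delta_y, delta_x>. *)
Definition op := X -> X -> R[i].

Definition op_add (a b : op) : op := fun x y => a x y + b x y.
Definition op_opp (a : op) : op := fun x y => - a x y.
Definition op_scale (c : R[i]) (a : op) : op := fun x y => c * a x y.
Definition op_one : op := fun x y => if x == y then 1 else 0.
Definition op_adj (a : op) : op := fun x y => (a y x)^*.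

(* ||a|| <= M : for all finitely supported vectors xi, eta,
   |<a xi, eta>| <= M ||xi|| ||eta||  (squared form). *)
Definition op_norm_le (a : op) (M : R) : Prop :=
  0 <= M /\
  forall (A B : {fset X}) (xi eta : X -> R[i]),
    `| \sum_(x <- A) \sum_(y <- B) (eta x)^* * a x y * xi y | ^+ 2
      <= (M ^+ 2)%:C * (\sum_(x <- A) `|eta x| ^+ 2) * (\sum_(y <- B) `|xi y| ^+ 2).

Definition bounded_op (a : op) : Prop := exists M : R, op_norm_le a M.

Definition has_sum (f : X -> R[i]) (l : R[i]) : Prop :=
  forall e : R, 0 < e -> exists A : {fset X}, forall B : {fset X},
    (A `<=` B)%fset -> `| \sum_(y <- B) f y - l | < e%:C.

Definition op_mul (a b : op) : op := fun x z =>
  xget 0 [set l | has_sum (fun y => a x y * b y z) l]%classic.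

Definition prop_le (d : X -> X -> R) (a : op) (r : R) : Prop :=
  forall x y, a x y != 0 -> d x y <= r.

Definition roe_alg (d : X -> X -> R) (a : op) : Prop :=
  bounded_op a /\ exists r : R, prop_le d a r.

Definition uroe (d : X -> X -> R) (a : op) : Prop :=
  bounded_op a /\
  forall e : R, 0 < e -> exists b, roe_alg d b /\ op_norm_le (op_add a (op_opp b)) e.

Definition is_metric (d : X -> X -> R) : Prop :=
  [/\ forall x y, 0 <= d x y, forall x y, d x y = 0 <-> x = y,
      forall x y, d x y = d y x & forall x y z, d x z <= d x y + d y z].

Definition ulf (d : X -> X -> R) : Prop :=
  forall r : R, 0 < r -> exists N : nat, forall (x : X) (s : seq X),
    uniq s -> all (fun y => d x y <= r) s -> (size s <= N)%N.

Definition coarse (d : X -> X -> R) (h : X -> R) : Prop :=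
  forall r : R, 0 < r -> exists s : R, 0 < s /\
    forall x y, d x y < r -> `|h x - h y| < s.

Definition expi (t : R) : R[i] := (cos t)%:C + 'i * (sin t)%:C.

(* sigma_{h,t}(a) = e^{it h} a e^{-it h}, entrywise *)
Definition sigma (h : X -> R) (t : R) (a : op) : op :=
  fun x y => expi (t * (h x - h y)) * a x y.

Definition entire_op (d : X -> X -> R) (F : R[i] -> op) : Prop :=
  (forall z, uroe d (F z)) /\
  forall z, exists D : op, forall e : R, 0 < e -> exists delta : R, 0 < delta /\
    forall w : R[i], w != 0 -> `|w| < delta%:C ->
      op_norm_le (op_add (op_scale w^-1 (op_add (F (z + w)) (op_opp (F z))))
                         (op_opp D)) e.

Definition analytic_ext (d : X -> X -> R) (h : X -> R) (b : op) (F : R[i] -> op) : Prop :=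
  entire_op d F /\ forall t : R, F t%:C = sigma h t b.

Definition is_state (d : X -> X -> R) (phi : op -> R[i]) : Prop :=
  [/\ (forall a b, uroe d a -> uroe d b -> phi (op_add a b) = phi a + phi b),
      (forall c a, uroe d a -> phi (op_scale c a) = c * phi a),
      (forall a, uroe d a -> 0 <= phi (op_mul (op_adj a) a))
    & phi op_one = 1].

Definition is_KMS (d : X -> X -> R) (h : X -> R) (beta : R) (phi : op -> R[i]) : Prop :=
  is_state d phi /\
  forall a b F, uroe d a -> uroe d b -> analytic_ext d h b F ->
    phi (op_mul a (F ('i * beta%:C))) = phi (op_mul b a).

Definition condexp (a : op) : op := fun x y => if x == y then a x x else 0.

End Roe.

(* Main.v *)
(* A diagonal operator f is fixed by the flow, so its orbit is the constant
   entire map and the KMS condition reads phi(a f) = phi(f a).  If a has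
   propagation at most r, colour X with finitely many colours so that points at
   distance at most r get distinct colours, and let p_i be the projection on the
   i-th colour class.  Then p_i a p_i = p_i E(a), whence
   phi(a) = sum_i phi(p_i p_i a) = sum_i phi(p_i a p_i) = phi(E(a)).
   The general case follows by density once phi is known to be norm continuous.
   For this, a self-adjoint x with ||x|| <= 1/2 satisfies 1 - x = (1 - y)^* (1 - y),
   where y is the fixed point of the contraction y |-> (x + y^2)/2 on the ball of
   radius 1/2 of the uniform Roe algebra; positivity of phi then gives phi(x) <= 1. *)
Require Import Defs.
From HB Require Import structures.
From mathcomp Require Import all_boot all_order all_algebra finmap.
From mathcomp Require Import complex.
From mathcomp Require Import boolp classical_sets reals trigo.
From mathcomp Require Import ring lra.

Set Implicit Arguments.
Unset Strict Implicit.
Unset Printing Implicit Defensive.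

Import Order.TTheory GRing.Theory Num.Theory.
Import ComplexField.
Local Open Scope ring_scope.
Local Open Scope complex_scope.

Local Notation normc := Normc.normc.

(** * The modulus of a complex number as a real number *)

Section ComplexNorm.
Variable R : realType.
Implicit Types z w : R[i].

Lemma normr_normc z : `|z| = (normc z)%:C.
Proof. by []. Qed.

Lemma normc_ge0 z : 0 <= normc z.
Proof. by rewrite -lecR -normr_normc; exact: normr_ge0. Qed.

Lemma normc_D z w : normc (z + w) <= normc z + normc w.
Proof. by rewrite -lecR rmorphD /= -!normr_normc ler_normD. Qed.

Lemma normc_N z : normc (- z) = normc z.
Proof. by apply: complexI; rewrite -!normr_normc normrN. Qed.

Lemma normc_distC z w : normc (z - w) = normc (w - z).
Proof. by rewrite -normc_N opprB. Qed.

Lemma normc_conj z : normc z^* = normc z.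
Proof. by case: z => a b; rewrite /= sqrrN. Qed.

Lemma normc_real (r : R) : normc r%:C = `|r|.
Proof. by rewrite /= expr0n addr0 sqrtr_sqr. Qed.

Lemma normc_sum (I : Type) (s : seq I) (F : I -> R[i]) :
  normc (\sum_(i <- s) F i) <= \sum_(i <- s) normc (F i).
Proof.
elim/big_rec2: _ => [|i x y _ h]; first by rewrite Normc.normc0.
by apply: le_trans (normc_D _ _) _; rewrite lerD2l.
Qed.

Lemma normc_sqr z : (normc z ^+ 2)%:C = z * z^*.
Proof. by rewrite rmorphXn /= -normr_normc sqr_normc. Qed.

Lemma normc_le_eps z : (forall e : R, 0 < e -> normc z <= e) -> z = 0.
Proof.
move=> h; apply: Normc.eq0_normc; apply/eqP; rewrite eq_le normc_ge0 andbT.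
by apply/ler_addgt0Pl => e /h; rewrite addr0.
Qed.

Lemma complex_ReIm z : z = (complex.Re z)%:C + (0 +i* 1) * (complex.Im z)%:C.
Proof.
case: z => u v; apply/eqP; rewrite eq_complex /=.
by rewrite !(mul0r, mulr0, mul1r, subr0, addr0, add0r) !eqxx.
Qed.

Lemma normc_i : normc (0 +i* 1 : R[i]) = 1.
Proof. by rewrite /= expr0n expr1n add0r sqrtr1. Qed.

Lemma normc_le_ReIm z : normc z <= `|complex.Re z| + `|complex.Im z|.
Proof.
rewrite [in X in X <= _](complex_ReIm z); apply: le_trans (normc_D _ _) _.
by rewrite Normc.normcM normc_i mul1r !normc_real.
Qed.

Lemma normc_Re_le z : `|complex.Re z| <= normc z.
Proof. by rewrite -lecR; exact: normc_ge_Re. Qed.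

Lemma normc_Im_le z : `|complex.Im z| <= normc z.
Proof.
case: z => u v /=; rewrite -sqrtr_sqr ler_sqrt ?addr_ge0 ?sqr_ge0 //.
by rewrite lerDr sqr_ge0.
Qed.

End ComplexNorm.

(** * Cauchy-Schwarz for finite real sums *)

Section RealSums.
Variable R : realType.

(** Induction on the list. The cross term is controlled through its square: as [S ^+ 2 <= P * Q],
    the difference of the two squares is at least the perfect square
    [(a ^+ 2 * Q - b ^+ 2 * P) ^+ 2]. *)
Lemma cauchy_schwarz_seq (I : Type) (s : seq I) (u v : I -> R) :
  (\sum_(i <- s) u i * v i) ^+ 2
    <= (\sum_(i <- s) u i ^+ 2) * (\sum_(i <- s) v i ^+ 2).
Proof.
have ge0 (w : I -> R) t : 0 <= \sum_(i <- t) w i ^+ 2.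
  by apply: sumr_ge0 => i _; exact: sqr_ge0.
elim: s => [|i s ih]; first by rewrite !big_nil expr0n mulr0.
rewrite !big_cons; move: ih (ge0 u s) (ge0 v s).
set S := \sum_(j <- s) _; set P := \sum_(j <- s) _; set Q := \sum_(j <- s) _.
move: (u i) (v i) S P Q => a b S P Q ih P0 Q0.
have key : 2 * (a * b * S) <= a ^+ 2 * Q + b ^+ 2 * P.
  have h0 : 0 <= a ^+ 2 * Q + b ^+ 2 * P.
    by apply: addr_ge0; apply: mulr_ge0 => //; exact: sqr_ge0.
  apply: le_trans (ler_norm _) _.
  rewrite -(@ler_pXn2r _ 2) ?nnegrE // real_normK ?num_real //.
  have h1 : (2 * (a * b * S)) ^+ 2 <= 4 * (a ^+ 2 * b ^+ 2) * (P * Q).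
    have -> : (2 * (a * b * S)) ^+ 2 = 4 * (a ^+ 2 * b ^+ 2) * S ^+ 2 by ring.
    by apply: ler_wpM2l ih; rewrite mulr_ge0 // mulr_ge0 // sqr_ge0.
  apply: le_trans h1 _; rewrite -subr_ge0.
  have -> : (a ^+ 2 * Q + b ^+ 2 * P) ^+ 2 - 4 * (a ^+ 2 * b ^+ 2) * (P * Q)
          = (a ^+ 2 * Q - b ^+ 2 * P) ^+ 2 by ring.
  exact: sqr_ge0.
have -> : (a * b + S) ^+ 2 = a ^+ 2 * b ^+ 2 + 2 * (a * b * S) + S ^+ 2 by ring.
have -> : (a ^+ 2 + P) * (b ^+ 2 + Q)
   = a ^+ 2 * b ^+ 2 + (a ^+ 2 * Q + b ^+ 2 * P) + P * Q by ring.
by apply: lerD ih; rewrite lerD2l.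
Qed.

End RealSums.

(** * Truncated l2 norms and operator norm bounds *)

Section L2.
Variables (R : realType) (X : choiceType).
Implicit Types (A B : {fset X}) (f g : X -> R[i]) (a b c : op R X) (M N : R).

Definition l2 A f : R := Num.sqrt (\sum_(x <- A) normc (f x) ^+ 2).

Lemma l2_ge0 A f : 0 <= l2 A f.
Proof. exact: sqrtr_ge0. Qed.

Lemma l2_sqr A f : l2 A f ^+ 2 = \sum_(x <- A) normc (f x) ^+ 2.
Proof. by rewrite sqr_sqrtr // sumr_ge0 // => x _; exact: sqr_ge0. Qed.

Lemma l2_sqrC A f : (l2 A f ^+ 2)%:C = \sum_(x <- A) `|f x| ^+ 2.
Proof.
rewrite l2_sqr rmorph_sum /=; apply: eq_bigr => x _.
by rewrite rmorphXn /= -normr_normc.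
Qed.

Lemma l2_cauchy_schwarz A f g :
  \sum_(x <- A) normc (f x) * normc (g x) <= l2 A f * l2 A g.
Proof.
apply: le_trans (ler_norm _) _.
rewrite -(@ler_pXn2r _ 2) ?nnegrE ?mulr_ge0 ?l2_ge0 // real_normK ?num_real //.
by rewrite exprMn !l2_sqr cauchy_schwarz_seq.
Qed.

Lemma l2_conj A f : l2 A (fun x => (f x)^*) = l2 A f.
Proof. by rewrite /l2; under eq_bigr do rewrite normc_conj. Qed.

Definition op_form a A B (xi eta : X -> R[i]) : R[i] :=
  \sum_(x <- A) \sum_(y <- B) (eta x)^* * a x y * xi y.

(** Both sides of the defining inequality are squares of nonnegative reals; taking roots gives a
    real bound linear in [M]. *)
Lemma op_norm_leP a M : op_norm_le a M <-> 0 <= M /\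
  forall A B xi eta, normc (op_form a A B xi eta) <= M * l2 A eta * l2 B xi.
Proof.
split=> -[M0 h]; split=> // A B xi eta; have := h A B xi eta.
- rewrite -!l2_sqrC -!rmorphM normr_normc -rmorphXn lecR -!exprMn.
  by rewrite ler_pXn2r ?nnegrE ?mulr_ge0 ?l2_ge0 ?normc_ge0.
- rewrite -!l2_sqrC -!rmorphM normr_normc -rmorphXn lecR -!exprMn.
  by rewrite ler_pXn2r ?nnegrE ?mulr_ge0 ?l2_ge0 ?normc_ge0.
Qed.

Lemma op_norm_le_ge0 a M : op_norm_le a M -> 0 <= M.
Proof. by case. Qed.

Lemma op_norm_leW a M N : M <= N -> op_norm_le a M -> op_norm_le a N.
Proof.
move=> MN /op_norm_leP[M0 h]; apply/op_norm_leP; split=> [|A B xi eta].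
  exact: le_trans MN.
by apply: le_trans (h _ _ _ _) _; rewrite -!mulrA ler_wpM2r ?mulr_ge0 ?l2_ge0.
Qed.

Lemma op_form_add a b A B xi eta :
  op_form (op_add a b) A B xi eta = op_form a A B xi eta + op_form b A B xi eta.
Proof.
rewrite /op_form -big_split; apply: eq_bigr => x _ /=.
by rewrite -big_split; apply: eq_bigr => y _ /=; rewrite /op_add mulrDr mulrDl.
Qed.

Lemma op_form_scale k a A B xi eta :
  op_form (op_scale k a) A B xi eta = k * op_form a A B xi eta.
Proof.
rewrite /op_form mulr_sumr; apply: eq_bigr => x _ /=.
rewrite mulr_sumr; apply: eq_bigr => y _ /=; rewrite /op_scale; ring.
Qed.

Lemma op_norm_le_add a b M N :
  op_norm_le a M -> op_norm_le b N -> op_norm_le (op_add a b) (M + N).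
Proof.
move=> /op_norm_leP[M0 ha] /op_norm_leP[N0 hb]; apply/op_norm_leP.
split=> [|A B xi eta]; first exact: addr_ge0.
rewrite op_form_add; apply: le_trans (normc_D _ _) _.
by rewrite !mulrDl lerD.
Qed.

Lemma op_norm_le_scale k a M :
  op_norm_le a M -> op_norm_le (op_scale k a) (normc k * M).
Proof.
move=> /op_norm_leP[M0 ha]; apply/op_norm_leP.
split=> [|A B xi eta]; first by rewrite mulr_ge0 ?normc_ge0.
by rewrite op_form_scale Normc.normcM -!mulrA ler_wpM2l ?normc_ge0 // mulrA.
Qed.

Lemma op_oppE a : op_opp a = op_scale (- 1) a.
Proof. by apply/funext => x; apply/funext => y; rewrite /op_opp /op_scale mulN1r. Qed.

Lemma op_norm_le_opp a M : op_norm_le a M -> op_norm_le (op_opp a) M.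
Proof.
move=> /(op_norm_le_scale (- 1)).
by rewrite normc_N Normc.normc1 mul1r -op_oppE.
Qed.

Lemma op_norm_le_adj a M : op_norm_le a M -> op_norm_le (op_adj a) M.
Proof.
move=> /op_norm_leP[M0 ha]; apply/op_norm_leP; split=> // A B xi eta.
have -> : op_form (op_adj a) A B xi eta = (op_form a B A eta xi)^*.
  rewrite /op_form rmorph_sum exchange_big; apply: eq_bigr => y _ /=.
  rewrite rmorph_sum; apply: eq_bigr => x _ /=.
  by rewrite /op_adj !rmorphM /= conjcK; ring.
by rewrite normc_conj mulrAC.
Qed.

Lemma op_norm_le_entry a M x y : op_norm_le a M -> normc (a x y) <= M.
Proof.
move=> /op_norm_leP[_ /(_ [fset x]%fset [fset y]%fset (fun=> 1) (fun=> 1))].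
rewrite /op_form /l2 !big_seq_fset1 Normc.normc1 expr1n sqrtr1 !mulr1.
by rewrite rmorph1 mul1r.
Qed.

Lemma sum_if_eq A x (F : X -> R[i]) :
  \sum_(y <- A) (if x == y then F y else 0) = if x \in A then F x else 0.
Proof.
case: ifPn => xA.
  rewrite (big_fsetD1 x) //= eqxx big_seq big1 ?addr0 // => y.
  by rewrite in_fsetD1 eq_sym => /andP[/negbTE ->].
rewrite big_seq big1 // => y yA; case: eqP => // xy.
by rewrite xy yA in xA.
Qed.

Definition op_diag f : op R X := fun x y => if x == y then f x else 0.

Lemma op_norm_le_diag f M :
  0 <= M -> (forall x, normc (f x) <= M) -> op_norm_le (op_diag f) M.
Proof.
move=> M0 fM; apply/op_norm_leP; split=> // A B xi eta.
have -> : op_form (op_diag f) A B xi eta =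
    \sum_(x <- A) (eta x)^* * f x * (if x \in B then xi x else 0).
  apply: eq_bigr => x _.
  rewrite -sum_if_eq mulr_sumr; apply: eq_bigr => y _; rewrite /op_diag.
  by case: eqP => [->//|_]; rewrite !mulr0 mul0r.
(* Only points of both [A] and [B] contribute. Cutting [xi] off outside [B] leaves a single sum over
   [A], ready for Cauchy-Schwarz. *)
set xi' := fun x => if x \in B then xi x else 0.
have hxi : l2 A xi' <= l2 B xi.
  rewrite ler_sqrt ?sumr_ge0 // => [|x _]; last exact: sqr_ge0.
  have -> : \sum_(x <- A) normc (xi' x) ^+ 2
          = \sum_(x <- A | x \in B) normc (xi x) ^+ 2.
    rewrite [RHS]big_mkcond /=; apply: eq_bigr => x _.
    by rewrite /xi'; case: ifP => // _; rewrite Normc.normc0 expr0n.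
  rewrite -big_filter (perm_big [seq x <- B | x \in A]).
    rewrite big_filter big_mkcond /=; apply: ler_sum => x _.
    by case: ifP => // _; exact: sqr_ge0.
  apply: uniq_perm => [||x]; rewrite ?filter_uniq ?fset_uniq //.
  by rewrite !mem_filter andbC.
apply: le_trans (normc_sum _ _) _.
apply: (@le_trans _ _ (\sum_(x <- A) M * (normc (eta x) * normc (xi' x)))).
  apply: ler_sum => x _; rewrite !Normc.normcM normc_conj.
  rewrite [normc (eta x) * _]mulrC -mulrA ler_wpM2r //.
  by rewrite mulr_ge0 ?normc_ge0.
rewrite -mulr_sumr -mulrA; apply: ler_wpM2l => //.
by apply: le_trans (l2_cauchy_schwarz _ _ _) _; rewrite ler_wpM2l ?l2_ge0.
Qed.

(** A form over finite [A] and [B] involves finitely many entries, so entrywise approximation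
    carries the bound over to [a]. *)
Lemma op_norm_le_closed a M :
  0 <= M ->
  (forall e, 0 < e -> exists b, op_norm_le b M /\ forall x y, normc (a x y - b x y) <= e) ->
  op_norm_le a M.
Proof.
move=> M0 h; apply/op_norm_leP; split=> // A B xi eta.
(* Entry errors of size t change the form by at most t * [K]; dividing by [K + 1] avoids a zero
   denominator. *)
pose K := \sum_(x <- A) \sum_(y <- B) normc (eta x) * normc (xi y).
have K0 : 0 <= K.
  by do 2!(apply: sumr_ge0 => ? _); rewrite mulr_ge0 ?normc_ge0.
apply/ler_addgt0Pr => e e0.
have [|b [/op_norm_leP[_ hb] hab]] := h (e / (K + 1)).
  by rewrite divr_gt0 // ltr_wpDl.
have -> : a = op_add (op_add a (op_opp b)) b.
  by apply/funext => x; apply/funext => y; rewrite /op_add /op_opp subrK.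
rewrite op_form_add addrC; apply: le_trans (normc_D _ _) _; rewrite lerD //.
apply: (@le_trans _ _ (e / (K + 1) * K)); last first.
  rewrite -mulrA ger_pMr // mulrC ler_pdivrMr ?mul1r ?lerDl //.
  by rewrite ltr_wpDl.
apply: le_trans (normc_sum _ _) _; rewrite mulr_sumr; apply: ler_sum => x _.
apply: le_trans (normc_sum _ _) _; rewrite mulr_sumr; apply: ler_sum => y _.
rewrite !Normc.normcM normc_conj mulrAC mulrC.
by apply: ler_wpM2r; [rewrite mulr_ge0 ?normc_ge0 | exact: hab].
Qed.

End L2.

(** * Unordered sums *)

Section HasSum.
Variables (R : realType) (X : choiceType).
Implicit Types (A B : {fset X}) (f g : X -> R[i]) (l m k : R[i]).

Lemma has_sumP f l : has_sum f l <-> forall e : R, 0 < e ->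
  exists A, forall B, (A `<=` B)%fset -> normc (\sum_(y <- B) f y - l) < e.
Proof.
split=> h e /h[A hA]; exists A => B /hA; by rewrite normr_normc ltcR.
Qed.

Lemma has_sum_unique f l m : has_sum f l -> has_sum f m -> l = m.
Proof.
move=> /has_sumP hl /has_sumP hm; apply/eqP; rewrite -subr_eq0; apply/eqP.
apply: normc_le_eps => e e0.
have e2 : 0 < e / 2 by rewrite divr_gt0.
have [A hA] := hl _ e2; have [B hB] := hm _ e2.
have := hA _ (fsubsetUl A B); have := hB _ (fsubsetUr A B).
set S := \sum_(y <- _) _ => h1 h2.
have -> : l - m = (l - S) + (S - m) by ring.
apply: le_trans (normc_D _ _) _; rewrite normc_distC.
by rewrite [e]splitr lerD // ltW.
Qed.

Lemma has_sumD f g l m :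
  has_sum f l -> has_sum g m -> has_sum (fun y => f y + g y) (l + m).
Proof.
move=> /has_sumP hl /has_sumP hm; apply/has_sumP => e e0.
have e2 : 0 < e / 2 by rewrite divr_gt0.
have [A hA] := hl _ e2; have [B hB] := hm _ e2.
exists (A `|` B)%fset => C; rewrite fsubUset => /andP[/hA hA' /hB hB'].
rewrite big_split /= opprD addrACA.
by apply: le_lt_trans (normc_D _ _) _; rewrite [e]splitr ltrD.
Qed.

Lemma has_sumZ k f l : has_sum f l -> has_sum (fun y => k * f y) (k * l).
Proof.
move=> /has_sumP hl; apply/has_sumP => e e0.
have k0 : 0 < normc k + 1 by rewrite ltr_wpDl ?normc_ge0.
have [A hA] := hl _ (divr_gt0 e0 k0).
exists A => B /hA; rewrite -mulr_sumr -mulrBr Normc.normcM ltr_pdivlMr // => h.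
apply: le_lt_trans h; rewrite mulrC ler_wpM2l ?normc_ge0 //.
by rewrite lerDl.
Qed.

Lemma has_sum_conj f l : has_sum f l -> has_sum (fun y => (f y)^*) l^*.
Proof.
move=> /has_sumP hl; apply/has_sumP => e /hl[A hA].
by exists A => B /hA; rewrite -rmorph_sum -rmorphB normc_conj.
Qed.

Lemma has_sum_finite f A :
  (forall y, y \notin A -> f y = 0) -> has_sum f (\sum_(y <- A) f y).
Proof.
move=> h; apply/has_sumP => e e0; exists A => B AB.
rewrite (big_fset_incl _ AB) ?subrr ?Normc.normc0 // => x _; exact: h.
Qed.

Lemma has_sum0 : has_sum (fun _ : X => 0 : R[i]) 0.
Proof.
have := @has_sum_finite (fun _ => 0) fset0 (fun _ _ => erefl).
by rewrite big_seq_fset0.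
Qed.

Lemma has_sum_sum (I : Type) (s : seq I) (F : I -> X -> R[i]) (L : I -> R[i]) :
  (forall i, has_sum (F i) (L i)) ->
  has_sum (fun y => \sum_(i <- s) F i y) (\sum_(i <- s) L i).
Proof.
move=> h; elim: s => [|i s ih].
  by rewrite big_nil; under eq_fun do rewrite big_nil; exact: has_sum0.
rewrite big_cons; under eq_fun do rewrite big_cons.
exact: has_sumD.
Qed.

Lemma has_sum_norm_le f l (K : R) :
  has_sum f l -> (forall A, normc (\sum_(y <- A) f y) <= K) -> normc l <= K.
Proof.
move=> /has_sumP hl h; apply/ler_addgt0Pr => e /hl[A /(_ A (fsubset_refl A)) hA].
have -> : l = \sum_(y <- A) f y + (l - \sum_(y <- A) f y) by rewrite addrC subrK.
apply: le_trans (normc_D _ _) _; rewrite lerD // normc_distC; exact: ltW.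
Qed.

(** Partial sums grow with the finite set, so their supremum is the sum. *)
Lemma has_sum_nneg (f : X -> R) (K : R) :
  (forall y, 0 <= f y) -> (forall A, \sum_(y <- A) f y <= K) ->
  exists l : R, has_sum (fun y => (f y)%:C) l%:C.
Proof.
move=> f0 fK.
pose E : set R := [set s | exists A, s = \sum_(y <- A) f y]%classic.
have supE : has_sup E.
  split; first by exists 0, fset0; rewrite big_seq_fset0.
  by exists K => _ [A ->].
exists (sup E); apply/has_sumP => e e0.
have [_ [A ->] hA] := sup_adherent e0 supE.
exists A => B AB; rewrite -rmorph_sum -rmorphB normc_real.
have BE : \sum_(y <- B) f y <= sup E.
  by apply: sup_upper_bound => //; exists B.
have AleB : \sum_(y <- A) f y <= \sum_(y <- B) f y.
  have -> : \sum_(y <- A) f y = \sum_(y <- A) (if y \in A then f y else 0).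
    by rewrite !big_seq; apply: eq_bigr => y ->.
  rewrite (big_fset_incl _ AB); last by move=> y _ /negbTE ->.
  by apply: ler_sum => y _; case: ifP.
by rewrite ler0_norm ?subr_le0 // opprB ltrBlDr -ltrBlDl; apply: lt_le_trans AleB.
Qed.

(** Writes [f] as the difference of the nonnegative families |f| + f and |f|. *)
Lemma has_sum_real (f : X -> R) (K : R) :
  (forall A, \sum_(y <- A) `|f y| <= K) ->
  exists l : R, has_sum (fun y => (f y)%:C) l%:C.
Proof.
move=> fK.
have [l1 h1] := has_sum_nneg (fun y => normr_ge0 (f y)) fK.
have [||l2 h2] := @has_sum_nneg (fun y => `|f y| + f y) (K + K).
- by move=> y; have := ler_norm (- f y); rewrite normrN; lra.
- move=> A; rewrite big_split /= lerD //.
  by apply: le_trans (fK A); apply: ler_sum => y _; exact: ler_norm.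
exists (l2 - l1).
have := has_sumD h2 (has_sumZ (-1) h1); rewrite mulN1r -rmorphB /=.
suff -> : (fun y => (`|f y| + f y)%:C + -1 * `|f y|%:C) = (fun y => (f y)%:C) by [].
by apply/funext => y; rewrite mulN1r -rmorphB /= addrC addKr.
Qed.

Lemma has_sum_exists f (K : R) :
  (forall A, \sum_(y <- A) normc (f y) <= K) -> exists l, has_sum f l.
Proof.
move=> fK.
have [|l1 h1] := @has_sum_real (fun y => complex.Re (f y)) K.
  move=> A; apply: le_trans (fK A); apply: ler_sum => y _.
  exact: normc_Re_le.
have [|l2 h2] := @has_sum_real (fun y => complex.Im (f y)) K.
  move=> A; apply: le_trans (fK A); apply: ler_sum => y _.
  exact: normc_Im_le.
exists (l1%:C + (0 +i* 1) * l2%:C).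
have := has_sumD h1 (has_sumZ (0 +i* 1) h2).
by under eq_fun do rewrite -complex_ReIm.
Qed.

End HasSum.

(** * Products of bounded operators *)

Section Product.
Variables (R : realType) (X : choiceType).
Implicit Types (A B C : {fset X}) (a b c : op R X) (M N : R) (xi eta : X -> R[i]).

(** Unordered sums are unique, so the choice made in [op_mul] returns any sum that can be
    exhibited. *)
Lemma op_mulE a b x z l :
  has_sum (fun y => a x y * b y z) l -> op_mul a b x z = l.
Proof.
by move=> h; apply: xget_unique => // m hm; exact: has_sum_unique hm h.
Qed.

(** Duality: testing against the conjugate of [u] gives ||u||^2 <= M ||eta|| ||u||, and a factor
    ||u|| cancels unless it is zero. *)
Lemma op_norm_le_row a M A B eta :
  op_norm_le a M -> l2 B (fun y => \sum_(x <- A) (eta x)^* * a x y) <= M * l2 A eta.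
Proof.
move=> /op_norm_leP[M0 ha].
set u := fun y => _; have := ha A B (fun y => (u y)^*) eta.
have -> : op_form a A B (fun y => (u y)^*) eta = (l2 B u ^+ 2)%:C.
  rewrite /op_form exchange_big l2_sqr rmorph_sum; apply: eq_bigr => y _ /=.
  by rewrite -mulr_suml -/(u y) -normc_sqr.
rewrite l2_conj normc_real ger0_norm ?sqr_ge0 // expr2.
have := l2_ge0 B u; rewrite le_eqVlt => /predU1P[<- _|u0].
  by rewrite mulr_ge0 ?l2_ge0.
by rewrite ler_pM2r.
Qed.

Lemma op_norm_le_col a M A B xi :
  op_norm_le a M -> l2 A (fun x => \sum_(y <- B) a x y * xi y) <= M * l2 B xi.
Proof.
move=> /op_norm_le_adj ha; apply: le_trans (op_norm_le_row B A xi ha).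
rewrite -l2_conj le_eqVlt; apply/orP; left; apply/eqP; congr (l2 A _).
apply/funext => x; rewrite rmorph_sum; apply: eq_bigr => y _.
by rewrite rmorphM /= /op_adj mulrC.
Qed.

(** Row [x] of [a] and column [z] of [b] have l2 norms at most [M] and [N], so the entry series
    converges absolutely and [op_mul] does not fall back on its default. *)
Lemma op_mul_has_sum a b M N x z : op_norm_le a M -> op_norm_le b N ->
  has_sum (fun y => a x y * b y z) (op_mul a b x z).
Proof.
move=> ha hb.
have [|l hl] := @has_sum_exists _ _ (fun y => a x y * b y z) (M * N).
  move=> A; under eq_bigr do rewrite Normc.normcM.
  apply: le_trans (l2_cauchy_schwarz _ _ _) _.
  have := op_norm_le_row [fset x]%fset A (fun=> 1) ha.
  have := op_norm_le_col A [fset z]%fset (fun=> 1) hb.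
  rewrite /l2 !big_seq_fset1 Normc.normc1 expr1n sqrtr1 !mulr1 => hb' ha'.
  apply: ler_pM; rewrite ?sqrtr_ge0 //.
    move: ha'; under eq_bigr do rewrite big_seq_fset1 rmorph1 mul1r.
    exact.
  by move: hb'; under eq_bigr do rewrite big_seq_fset1 mulr1.
by rewrite (op_mulE hl).
Qed.

(** The form of the product is the sum of [u y * v y], where [v] is b applied to the truncated [xi]
    and [u] is, up to conjugation, the adjoint of a applied to the truncated [eta]. *)
Lemma op_norm_le_mul a b M N :
  op_norm_le a M -> op_norm_le b N -> op_norm_le (op_mul a b) (M * N).
Proof.
move=> ha hb; apply/op_norm_leP; split=> [|A B xi eta].
  by rewrite mulr_ge0 ?(op_norm_le_ge0 ha) ?(op_norm_le_ge0 hb).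
pose u y := \sum_(x <- A) (eta x)^* * a x y.
pose v y := \sum_(z <- B) b y z * xi z.
have hs : has_sum (fun y => u y * v y) (op_form (op_mul a b) A B xi eta).
  have := @has_sum_sum R X _ A (fun x y => \sum_(z <- B) ((eta x)^* * xi z) * (a x y * b y z))
    (fun x => \sum_(z <- B) (eta x)^* * xi z * op_mul a b x z).
  have -> : (fun y => \sum_(x <- A) \sum_(z <- B) (eta x)^* * xi z * (a x y * b y z)) =
            (fun y => u y * v y).
    apply/funext => y; rewrite mulr_suml; apply: eq_bigr => x _.
    by rewrite mulr_sumr; apply: eq_bigr => z _; ring.
  have -> : \sum_(x <- A) \sum_(z <- B) (eta x)^* * xi z * op_mul a b x z =
            op_form (op_mul a b) A B xi eta.
    by apply: eq_bigr => x _; apply: eq_bigr => z _; rewrite mulrAC.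
  apply=> x.
  apply: (@has_sum_sum R X _ B (fun z y => (eta x)^* * xi z * (a x y * b y z))) => z.
  by apply: has_sumZ; exact: op_mul_has_sum ha hb.
apply: has_sum_norm_le hs _ => C.
apply: le_trans (normc_sum _ _) _.
under eq_bigr do rewrite Normc.normcM.
apply: le_trans (l2_cauchy_schwarz _ _ _) _.
have -> : M * N * l2 A eta * l2 B xi = (M * l2 A eta) * (N * l2 B xi) by ring.
by apply: ler_pM; rewrite ?l2_ge0 //; [exact: op_norm_le_row|exact: op_norm_le_col].
Qed.

Lemma op_mul_addl a b c : bounded_op a -> bounded_op b -> bounded_op c ->
  op_mul (op_add a b) c = op_add (op_mul a c) (op_mul b c).
Proof.
move=> [M ha] [N hb] [K hc]; apply/funext => x; apply/funext => z.
apply: op_mulE; rewrite /op_add; under eq_fun do rewrite mulrDl.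
exact: has_sumD (op_mul_has_sum x z ha hc) (op_mul_has_sum x z hb hc).
Qed.

Lemma op_mul_addr a b c : bounded_op a -> bounded_op b -> bounded_op c ->
  op_mul a (op_add b c) = op_add (op_mul a b) (op_mul a c).
Proof.
move=> [M ha] [N hb] [K hc]; apply/funext => x; apply/funext => z.
apply: op_mulE; rewrite /op_add; under eq_fun do rewrite mulrDr.
exact: has_sumD (op_mul_has_sum x z ha hb) (op_mul_has_sum x z ha hc).
Qed.

Lemma op_mul_scalel k a b : bounded_op a -> bounded_op b ->
  op_mul (op_scale k a) b = op_scale k (op_mul a b).
Proof.
move=> [M ha] [N hb]; apply/funext => x; apply/funext => z.
apply: op_mulE; rewrite /op_scale; under eq_fun do rewrite -mulrA.
exact: has_sumZ (op_mul_has_sum x z ha hb).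
Qed.

Lemma op_mul_scaler k a b : bounded_op a -> bounded_op b ->
  op_mul a (op_scale k b) = op_scale k (op_mul a b).
Proof.
move=> [M ha] [N hb]; apply/funext => x; apply/funext => z.
apply: op_mulE; rewrite /op_scale; under eq_fun do rewrite mulrCA.
exact: has_sumZ (op_mul_has_sum x z ha hb).
Qed.

Lemma op_adj_mul a b : bounded_op a -> bounded_op b ->
  op_adj (op_mul a b) = op_mul (op_adj b) (op_adj a).
Proof.
move=> [M ha] [N hb]; apply/funext => x; apply/funext => z.
apply/esym/op_mulE; rewrite /op_adj; under eq_fun do rewrite -rmorphM mulrC.
exact: has_sum_conj (op_mul_has_sum z x ha hb).
Qed.

Lemma op_mul_diagl (f : X -> R[i]) a :
  op_mul (op_diag f) a = fun x z => f x * a x z.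
Proof.
apply/funext => x; apply/funext => z; apply: op_mulE.
have -> : f x * a x z = \sum_(y <- [fset x]%fset) op_diag f x y * a y z.
  by rewrite big_seq_fset1 /op_diag eqxx.
apply: has_sum_finite => y; rewrite in_fset1 eq_sym /op_diag => /negbTE ->.
by rewrite mul0r.
Qed.

Lemma op_mul_diagr (f : X -> R[i]) a :
  op_mul a (op_diag f) = fun x z => a x z * f z.
Proof.
apply/funext => x; apply/funext => z; apply: op_mulE.
have -> : a x z * f z = \sum_(y <- [fset z]%fset) a x y * op_diag f y z.
  by rewrite big_seq_fset1 /op_diag eqxx.
apply: has_sum_finite => y; rewrite in_fset1 /op_diag => /negbTE ->.
by rewrite mulr0.
Qed.

End Product.
Local Notation op_sub a b := (op_add a (op_opp b)).

(** Proves linear identities entry by entry; entries of products are atoms for [ring]. *)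
Local Ltac op_ring :=
  apply/funext => ?; apply/funext => ?; rewrite /op_add /op_opp /op_scale; ring.

(** * The uniform Roe algebra as a norm-closed star-algebra *)

Section RoeAlgebra.
Variables (R : realType) (X : choiceType) (d : X -> X -> R).
Hypothesis dM : is_metric d.
Implicit Types (a b c : op R X) (e M N r s : R).

Lemma op_mul_subl a b c : bounded_op a -> bounded_op b -> bounded_op c ->
  op_mul (op_sub a b) c = op_sub (op_mul a c) (op_mul b c).
Proof.
move=> ha [M hb] hc; rewrite op_mul_addl //; last first.
  by exists M; exact: op_norm_le_opp.
by rewrite !op_oppE op_mul_scalel //; exists M.
Qed.

Lemma op_mul_subr a b c : bounded_op a -> bounded_op b -> bounded_op c ->
  op_mul a (op_sub b c) = op_sub (op_mul a b) (op_mul a c).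
Proof.
move=> ha hb [M hc]; rewrite op_mul_addr //; last first.
  by exists M; exact: op_norm_le_opp.
by rewrite !op_oppE op_mul_scaler //; exists M.
Qed.

Lemma prop_leW a r s : r <= s -> prop_le d a r -> prop_le d a s.
Proof. by move=> rs h x y /h xy; exact: le_trans rs. Qed.

(** A nonzero entry needs some [y] with both factors nonzero, as otherwise the defining sum is zero;
    the triangle inequality then applies. *)
Lemma prop_le_mul a b r s :
  prop_le d a r -> prop_le d b s -> prop_le d (op_mul a b) (r + s).
Proof.
move=> ha hb x z nz.
have [y yP] : exists y, a x y * b y z != 0.
  apply: contrapT => /forallNP h; move/negP: nz; apply; apply/eqP.
  apply: op_mulE; rewrite (_ : (fun y => _) = (fun=> 0)); first exact: has_sum0.
  by apply/funext => y; apply/eqP; apply: contrapT => /negP; exact: h.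
move: yP; rewrite mulf_eq0 negb_or => /andP[/ha axy /hb byz].
by case: dM => _ _ _ tri; apply: le_trans (tri x y z) _; exact: lerD.
Qed.

Lemma roe_add a b : roe_alg d a -> roe_alg d b -> roe_alg d (op_add a b).
Proof.
move=> [[M ha] [r ar]] [[N hb] [s bs]]; split.
  by exists (M + N); exact: op_norm_le_add.
exists (Num.max r s) => x y.
have [a0|/ar h _] := eqVneq (a x y) 0; last by rewrite le_max h.
by rewrite /op_add a0 add0r => /bs h; rewrite le_max h orbT.
Qed.

Lemma roe_scale k a : roe_alg d a -> roe_alg d (op_scale k a).
Proof.
move=> [[M ha] [r ar]]; split; first by exists (normc k * M); exact: op_norm_le_scale.
by exists r => x y; rewrite /op_scale mulf_eq0 negb_or => /andP[_]; exact: ar.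
Qed.

Lemma roe_adj a : roe_alg d a -> roe_alg d (op_adj a).
Proof.
move=> [[M ha] [r ar]]; split; first by exists M; exact: op_norm_le_adj.
exists r => x y; rewrite /op_adj conjc_eq0 => /ar.
by case: dM => _ _ -> _.
Qed.

Lemma roe_mul a b : roe_alg d a -> roe_alg d b -> roe_alg d (op_mul a b).
Proof.
move=> [[M ha] [r ar]] [[N hb] [s bs]]; split.
  by exists (M * N); exact: op_norm_le_mul.
by exists (r + s); exact: prop_le_mul.
Qed.

Lemma roe_diag (f : X -> R[i]) M :
  0 <= M -> (forall x, normc (f x) <= M) -> roe_alg d (op_diag f).
Proof.
move=> M0 fM; split; first by exists M; exact: op_norm_le_diag.
exists 0 => x y; rewrite /op_diag; have [<- _|_] := eqVneq x y; last by rewrite eqxx.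
by case: dM => _ d0 _ _; rewrite ((d0 x x).2 erefl).
Qed.

Lemma op_norm_le_subrr a : op_norm_le (op_sub a a) 0.
Proof.
have -> : op_sub a a = op_diag (fun=> 0).
  apply/funext => x; apply/funext => y.
  by rewrite /op_add /op_opp /op_diag subrr; case: eqP.
by apply: op_norm_le_diag => // x; rewrite Normc.normc0.
Qed.

Lemma roe_uroe a : roe_alg d a -> uroe d a.
Proof.
move=> ha; split; first by case: ha.
move=> e e0; exists a; split=> //.
by apply: op_norm_leW (op_norm_le_subrr a); exact: ltW.
Qed.

Lemma uroe_bounded a : uroe d a -> bounded_op a.
Proof. by case. Qed.

(** Approximate twice within e/2. Closure under each operation then needs checking only on
    approximants of finite propagation. *)
Lemma uroe_closed a :
  (forall e, 0 < e -> exists2 b, uroe d b & op_norm_le (op_sub a b) e) -> uroe d a.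
Proof.
move=> h; split.
  have [b [[M hb] _] hab] := h 1 ltr01.
  exists (1 + M); have -> : a = op_add (op_sub a b) b by op_ring.
  exact: op_norm_le_add.
move=> e e0; have e2 : 0 < e / 2 by rewrite divr_gt0.
have [b [_ hb] hab] := h _ e2; have [c [hc hbc]] := hb _ e2.
exists c; split=> //; rewrite [e]splitr.
have -> : op_sub a c = op_add (op_sub a b) (op_sub b c) by op_ring.
exact: op_norm_le_add.
Qed.

Lemma uroe_add a b : uroe d a -> uroe d b -> uroe d (op_add a b).
Proof.
move=> [_ ha] [_ hb]; apply: uroe_closed => e e0.
have e2 : 0 < e / 2 by rewrite divr_gt0.
have [a' [ra haa]] := ha _ e2; have [b' [rb hbb]] := hb _ e2.
exists (op_add a' b'); first exact/roe_uroe/roe_add.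
have -> : op_sub (op_add a b) (op_add a' b') = op_add (op_sub a a') (op_sub b b').
  by op_ring.
by rewrite [e]splitr; exact: op_norm_le_add.
Qed.

Lemma uroe_scale k a : uroe d a -> uroe d (op_scale k a).
Proof.
move=> [_ ha]; apply: uroe_closed => e e0.
have k0 : 0 < normc k + 1 by rewrite ltr_wpDl ?normc_ge0.
have [a' [ra haa]] := ha _ (divr_gt0 e0 k0).
exists (op_scale k a'); first exact/roe_uroe/roe_scale.
have -> : op_sub (op_scale k a) (op_scale k a') = op_scale k (op_sub a a').
  by op_ring.
apply: op_norm_leW (op_norm_le_scale k haa).
rewrite mulrCA ger_pMr // ler_pdivrMr // mul1r lerDl ler01 //.
Qed.

Lemma uroe_opp a : uroe d a -> uroe d (op_opp a).
Proof. by rewrite op_oppE; exact: uroe_scale. Qed.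

Lemma uroe_sub a b : uroe d a -> uroe d b -> uroe d (op_sub a b).
Proof. by move=> ha /uroe_opp; exact: uroe_add. Qed.

Lemma op_adj_add a b : op_adj (op_add a b) = op_add (op_adj a) (op_adj b).
Proof. by apply/funext => x; apply/funext => y; rewrite /op_adj /op_add rmorphD. Qed.

Lemma op_adj_scale k a : op_adj (op_scale k a) = op_scale k^* (op_adj a).
Proof. by apply/funext => x; apply/funext => y; rewrite /op_adj /op_scale rmorphM. Qed.

Lemma op_adj_sub a b : op_adj (op_sub a b) = op_sub (op_adj a) (op_adj b).
Proof. by rewrite op_adj_add !op_oppE op_adj_scale rmorphN rmorph1. Qed.

Lemma op_adjK a : op_adj (op_adj a) = a.
Proof. by apply/funext => x; apply/funext => y; rewrite /op_adj conjcK. Qed.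

Lemma uroe_adj a : uroe d a -> uroe d (op_adj a).
Proof.
move=> [_ ha]; apply: uroe_closed => e /ha[a' [ra haa]].
exists (op_adj a'); first exact/roe_uroe/roe_adj.
by rewrite -op_adj_sub; exact: op_norm_le_adj.
Qed.

Lemma uroe_mul a b : uroe d a -> uroe d b -> uroe d (op_mul a b).
Proof.
move=> [[M bM] ha] [[N bN] hb]; apply: uroe_closed => e e0.
have M0 := op_norm_le_ge0 bM; have N0 := op_norm_le_ge0 bN.
(* The error of the product is at most [t * N + (t + M) * t], hence at most [t * K] because
   [t <= 1]; this dictates [K] and [t]. *)
pose K := M + N + 1; have K0 : 0 < K by rewrite ltr_wpDl ?addr_ge0.
pose t := Num.min 1 (e / K).
have t0 : 0 < t by rewrite lt_min ltr01 divr_gt0.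
have [a' [ra haa]] := ha _ t0; have [b' [rb hbb]] := hb _ t0.
exists (op_mul a' b'); first exact/roe_uroe/roe_mul.
have bM' : op_norm_le a' (t + M).
  have -> : a' = op_add (op_opp (op_sub a a')) a by op_ring.
  by apply: op_norm_le_add => //; exact: op_norm_le_opp.
have -> : op_sub (op_mul a b) (op_mul a' b') =
    op_add (op_mul (op_sub a a') b) (op_mul a' (op_sub b b')).
  have [Ba Bb] : bounded_op a /\ bounded_op b by split; [exists M|exists N].
  have [[Ba' _] [Bb' _]] := (ra, rb).
  by rewrite op_mul_subl // op_mul_subr //; op_ring.
apply: op_norm_leW (op_norm_le_add (op_norm_le_mul haa bN) (op_norm_le_mul bM' hbb)).
have t1 : t <= 1 by rewrite ge_min lexx.
have tK : t * K <= e by rewrite -ler_pdivlMr // ge_min lexx orbT.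
apply: le_trans tK; rewrite /K; have := ltW t0; nra.
Qed.

Lemma uroe_diag (f : X -> R[i]) M :
  0 <= M -> (forall x, normc (f x) <= M) -> uroe d (op_diag f).
Proof. by move=> M0 fM; apply: roe_uroe; exact: roe_diag fM. Qed.

Lemma op_oneE : @op_one R X = op_diag (fun=> 1).
Proof. by []. Qed.

Lemma uroe_one : uroe d (@op_one R X).
Proof.
by rewrite op_oneE; apply: (@uroe_diag _ 1) => // x; rewrite Normc.normc1.
Qed.

End RoeAlgebra.

(** * Limits of sequences with geometrically decreasing steps *)

Section Completeness.
Variables (R : realType) (X : choiceType).
Implicit Types (a b : op R X) (e C : R).

Lemma expr_half_gt0 n : 0 < (2^-1 : R) ^+ n.
Proof. by rewrite exprn_gt0 // invr_gt0. Qed.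

Lemma expr_half_small e C : 0 < e -> 0 <= C ->
  exists m, forall n, (m <= n)%N -> C * (2^-1) ^+ n <= e.
Proof.
move=> e0 C0; exists (Num.bound (C / e)) => n mn.
have h : C / e < n%:R.
  apply: lt_le_trans (archi_boundP _) _; first by rewrite divr_ge0 // ltW.
  by rewrite ler_nat.
rewrite exprVn ler_pdivrMr ?exprn_gt0 // mulrC -ler_pdivrMr //.
apply: le_trans (ltW h) _; rewrite -natrX ler_nat.
by apply: ltnW; exact: ltn_expl.
Qed.

(** The intervals of centre [u n] and radius [q n] are nested, and the supremum of their left ends
    lies in all of them. *)
Lemma real_geometric_limit (u : nat -> R) :
  (forall n, `|u n.+1 - u n| <= (2^-1) ^+ n.+1) ->
  exists l, forall n, `|l - u n| <= (2^-1) ^+ n.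
Proof.
move=> hu; pose q n := (2^-1 : R) ^+ n.
have q2 n : q n = q n.+1 + q n.+1 by rewrite /q exprS; field.
have lo n k : u n - q n <= u (k + n)%N - q (k + n)%N.
  elim: k => [//|k ih]; apply: le_trans ih _; rewrite addSn.
  have := hu (k + n)%N; rewrite -/(q _) ler_norml => /andP[+ _].
  have := q2 (k + n)%N; lra.
have hi n k : u (k + n)%N + q (k + n)%N <= u n + q n.
  elim: k => [//|k ih]; apply: le_trans ih; rewrite addSn.
  have := hu (k + n)%N; rewrite -/(q _) ler_norml => /andP[_ +].
  have := q2 (k + n)%N; lra.
pose E : set R := [set s | exists n, s = u n - q n]%classic.
have ub n : ubound E (u n + q n).
  move=> _ [m ->]; have := lo m n; have := hi n m; rewrite addnC.
  have := expr_half_gt0 (n + m); rewrite -/(q _); lra.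
have supE : has_sup E by split; [exists (u 0%N - q 0%N), 0%N|exists (u 0%N + q 0%N)].
exists (sup E) => n; rewrite -/(q n) ler_norml.
have h1 : u n - q n <= sup E by apply: sup_upper_bound => //; exists n.
have h2 : sup E <= u n + q n by apply: ge_sup (ub n); case: supE.
by apply/andP; split; lra.
Qed.

(** The limit is built entry by entry; telescoping bounds the distance from [Y n] to all later
    terms, and closedness of norm balls passes this bound to the limit. *)
Lemma op_geometric_limit (Y : nat -> op R X) :
  (forall n, op_norm_le (op_sub (Y n.+1) (Y n)) ((2^-1) ^+ n.+1)) ->
  exists y, forall n, op_norm_le (op_sub y (Y n)) ((2^-1) ^+ n).
Proof.
move=> hY.
(* The [eq_ind] term transports the entry bound along additivity of the real part. *)
have hre x z := @real_geometric_limit (fun n => complex.Re (Y n x z)) (fun n =>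
  le_trans (eq_ind _ (fun t => `|t| <= _) (normc_Re_le _) _ (raddfB _ _ _))
    (op_norm_le_entry x z (hY n))).
have him x z := @real_geometric_limit (fun n => complex.Im (Y n x z)) (fun n =>
  le_trans (eq_ind _ (fun t => `|t| <= _) (normc_Im_le _) _ (raddfB _ _ _))
    (op_norm_le_entry x z (hY n))).
(* The factor 2 adds the errors of the real and imaginary parts. It is harmless: only entrywise
   convergence is used, the norm bound coming from [hdist]. *)
have hlim x z : exists l, forall n, normc (l - Y n x z) <= 2 * (2^-1) ^+ n.
  have [l1 h1] := hre x z; have [l2 h2] := him x z.
  exists (l1 +i* l2) => n; apply: le_trans (normc_le_ReIm _) _.
  by rewrite mulr_natl mulr2n !raddfB; exact: lerD (h1 n) (h2 n).
pose l x z := sval (cid (hlim x z)).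
have hl x z : forall n, normc (l x z - Y n x z) <= 2 * (2^-1) ^+ n.
  exact: svalP (cid (hlim x z)).
exists l => n.
have hdist k : op_norm_le (op_sub (Y (k + n)%N) (Y n)) ((2^-1) ^+ n - (2^-1) ^+ (k + n)).
  elim: k => [|k ih]; first by rewrite subrr; exact: op_norm_le_subrr.
  have -> : op_sub (Y (k.+1 + n)%N) (Y n) =
    op_add (op_sub (Y (k + n).+1) (Y (k + n)%N)) (op_sub (Y (k + n)%N) (Y n)) by op_ring.
  have -> : (2^-1) ^+ n - (2^-1) ^+ (k.+1 + n) =
      (2^-1) ^+ (k + n).+1 + ((2^-1) ^+ n - (2^-1) ^+ (k + n)) :> R.
    by rewrite addSn exprS; field.
  exact: op_norm_le_add.
apply: op_norm_le_closed => [|e e0]; first exact/ltW/expr_half_gt0.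
have [m hm] := expr_half_small e0 (ler0n R 2).
exists (op_sub (Y (m + n)%N) (Y n)); split.
  by apply: op_norm_leW (hdist m); rewrite lerBlDr lerDl ltW ?expr_half_gt0.
move=> x z; apply: le_trans (hm _ (leq_addr n m)).
have -> : op_sub l (Y n) x z - op_sub (Y (m + n)%N) (Y n) x z = l x z - Y (m + n)%N x z.
  by rewrite /op_add /op_opp; ring.
exact: hl.
Qed.

Lemma op_eq_of_geometric C a b : 0 <= C ->
  (forall n, op_norm_le (op_sub a b) (C * (2^-1) ^+ n)) -> a = b.
Proof.
move=> C0 h; apply/funext => x; apply/funext => y; apply/eqP.
rewrite -subr_eq0; apply/eqP; apply: normc_le_eps => e e0.
have [m hm] := expr_half_small e0 C0.
exact: le_trans (op_norm_le_entry x y (h m)) (hm m _).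
Qed.

End Completeness.

(** * Square roots near the identity *)

Section SquareRoot.
Variables (R : realType) (X : choiceType) (d : X -> X -> R).
Hypothesis dM : is_metric d.
Implicit Types (x y : op R X).

Lemma normc_half : normc (2^-1 : R[i]) = 2^-1.
Proof.
rewrite Normc.normcV (_ : 2 = (2 : R)%:C); last by rewrite rmorph_nat.
by rewrite normc_real ger0_norm.
Qed.

Lemma op_one_mull x : op_mul (@op_one R X) x = x.
Proof.
by rewrite op_oneE op_mul_diagl; apply/funext => ?; apply/funext => ?; rewrite mul1r.
Qed.

Lemma op_one_mulr x : op_mul x (@op_one R X) = x.
Proof.
by rewrite op_oneE op_mul_diagr; apply/funext => ?; apply/funext => ?; rewrite mulr1.
Qed.

Lemma op_adj_one : op_adj (@op_one R X) = @op_one R X.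
Proof.
apply/funext => x; apply/funext => y; rewrite /op_adj /op_one eq_sym.
by case: eqP; rewrite ?conjc1 ?conjc0.
Qed.

(** Iterates [T] from [x]. The ball of radius 1/2 is preserved, since (1/2 + 1/4)/2 <= 1/2, and
    there [T] halves distances. Each iterate is self-adjoint in the algebra, and both properties
    survive the limit. *)
Lemma op_half_fixpoint x : uroe d x -> op_adj x = x -> op_norm_le x 2^-1 ->
  exists y, [/\ uroe d y, op_adj y = y & y = op_scale 2^-1 (op_add x (op_mul y y))].
Proof.
move=> ux xx hx.
pose T y := op_scale 2^-1 (op_add x (op_mul y y)).
pose Y n := iter n T x.
have uY n : uroe d (Y n).
  by elim: n => // n ih; apply: uroe_scale => //; apply: uroe_add => //; exact: uroe_mul.
have adjY n : op_adj (Y n) = Y n.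
  elim: n => // n ih; rewrite [Y n.+1]/(T (Y n)) /T op_adj_scale op_adj_add xx.
  rewrite op_adj_mul ?ih; try exact: uroe_bounded (uY n).
  by rewrite fmorphV rmorph_nat.
have hY n : op_norm_le (Y n) 2^-1.
  elim: n => // n ih; rewrite [Y n.+1]/(T (Y n)) /T.
  apply: op_norm_leW (op_norm_le_scale _ (op_norm_le_add hx (op_norm_le_mul ih ih))).
  rewrite normc_half; lra.
(* Uses y^2 - z^2 = (y - z) y + z (y - z), valid without commutation. The radii [K] and [L] stay
   separate because the limit gets a cruder bound than the iterates. *)
have hT y z K L e : op_norm_le y K -> op_norm_le z L -> op_norm_le (op_sub y z) e ->
    op_norm_le (op_sub (T y) (T z)) (2^-1 * (e * K + L * e)).
  move=> hy hz hyz; rewrite -normc_half.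
  have -> : op_sub (T y) (T z) =
      op_scale 2^-1 (op_add (op_mul (op_sub y z) y) (op_mul z (op_sub y z))).
    have [By Bz] : bounded_op y /\ bounded_op z by split; [exists K|exists L].
    by rewrite /T op_mul_subl // op_mul_subr //; op_ring.
  by apply: op_norm_le_scale; apply: op_norm_le_add; exact: op_norm_le_mul.
have [|y hy] := @op_geometric_limit R X Y.
  (* The first step has norm at most (1/4 + 1/2)/2 = 3/8, below the required 1/2; later steps are
     halved each time. *)
  elim=> [|n ih].
    have -> : op_sub (Y 1%N) (Y 0%N) = op_scale 2^-1 (op_sub (op_mul x x) x).
      rewrite /Y /= /T; apply/funext => ?; apply/funext => ?.
      by rewrite /op_add /op_opp /op_scale; field.
    have := op_norm_le_scale 2^-1 (op_norm_le_add (op_norm_le_mul hx hx) (op_norm_le_opp hx)).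
    by apply: op_norm_leW; rewrite normc_half; lra.
  apply: op_norm_leW (hT _ _ _ _ _ (hY n.+1) (hY n) ih).
  by rewrite [X in _ <= X]exprS; move: (_ ^+ n.+1) => t; lra.
have uy : uroe d y.
  apply: uroe_closed => e e0; have [m hm] := expr_half_small e0 ler01.
  exists (Y m) => //; apply: op_norm_leW (hy m).
  by have := hm m (leqnn m); rewrite mul1r.
(* With 3/2 for [y] and 1/2 for [Y n], the factor in [hT] is 1, which suffices to pass to the limit
   in the fixed-point equation. *)
have hy1 : op_norm_le y (1 + 2^-1).
  have -> : y = op_add (op_sub y (Y 0%N)) (Y 0%N) by op_ring.
  by apply: op_norm_le_add => //; have := hy 0%N; rewrite expr0.
exists y; split=> //.
- apply: (@op_eq_of_geometric _ _ 2) => // n.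
  have -> : op_sub (op_adj y) y = op_sub (op_adj (op_sub y (Y n))) (op_sub y (Y n)).
    by rewrite op_adj_sub adjY; op_ring.
  rewrite mulr_natl mulr2n; apply: op_norm_le_add; last exact: op_norm_le_opp.
  exact: op_norm_le_adj.
- apply: (@op_eq_of_geometric _ _ 2) => // n.
  have -> : op_sub y (T y) = op_sub (op_sub y (Y n.+1)) (op_sub (T y) (T (Y n))).
    by rewrite -[Y n.+1]/(T (Y n)); move: (Y n.+1) (T y) => ? ?; op_ring.
  have := op_norm_le_add (hy n.+1) (op_norm_le_opp (hT _ _ _ _ _ hy1 (hY n) (hy n))).
  apply: op_norm_leW; rewrite exprS.
  by have := expr_half_gt0 R n; move: (_ ^+ n) => t; lra.
Qed.

(** For [s = 1 - y], s^2 = 1 - 2y + y^2, and the fixed-point equation reads 2y = x + y^2. *)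
Lemma uroe_one_sub_sqr x : uroe d x -> op_adj x = x -> op_norm_le x 2^-1 ->
  exists2 s, uroe d s & op_mul (op_adj s) s = op_sub (@op_one R X) x.
Proof.
move=> ux xx hx; have [y [uy yy yE]] := op_half_fixpoint ux xx hx.
have u1 := uroe_one dM.
have us := uroe_sub u1 uy; exists (op_sub (@op_one R X) y) => //.
have [[B1 By] Bs] := (uroe_bounded u1, uroe_bounded uy, uroe_bounded us).
rewrite op_adj_sub op_adj_one yy op_mul_subl //.
rewrite op_one_mull op_mul_subr // op_one_mulr.
apply/funext => p; apply/funext => q; have /(congr1 (fun a => a p q)) := yE.
rewrite /op_add /op_opp /op_scale => yE'.
have -> : x p q = 2 * y p q - op_mul y y p q by rewrite {1}yE'; field.
by ring.
Qed.

End SquareRoot.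

(** * Norm continuity of states *)

Section State.
Variables (R : realType) (X : choiceType) (d : X -> X -> R) (phi : op R X -> R[i]).
Hypotheses (dM : is_metric d) (phiS : is_state d phi).
Implicit Types (a b c x : op R X) (e : R).

Lemma state_opp a : uroe d a -> phi (op_opp a) = - phi a.
Proof. by case: phiS => _ hZ _ _ ua; rewrite op_oppE hZ // mulN1r. Qed.

Lemma state_sub a b : uroe d a -> uroe d b -> phi (op_sub a b) = phi a - phi b.
Proof.
move=> ua ub; have ub' := uroe_opp ub.
by case: phiS => hD _ _ _; rewrite hD // state_opp.
Qed.

Lemma state_le1 x : uroe d x -> op_adj x = x -> op_norm_le x 2^-1 -> phi x <= 1.
Proof.
move=> ux xx hx; have [s us sE] := uroe_one_sub_sqr dM ux xx hx.
case: (phiS) => _ _ pos phi1; have := pos s us.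
by rewrite sE state_sub ?phi1 ?subr_ge0 //; exact: uroe_one.
Qed.

Lemma state_selfadj_bound x e :
  0 < e -> uroe d x -> op_adj x = x -> op_norm_le x e -> normc (phi x) <= 2 * e.
Proof.
(* Scaling by [t] brings the norm down to 1/2, so that [state_le1] applies to both [z] and its
   opposite. *)
move=> e0 ux xx hx; pose t := (2 * e)^-1.
have t0 : 0 < t by rewrite invr_gt0 mulr_gt0.
pose z := op_scale t%:C x.
have uz : uroe d z by exact: uroe_scale.
have zz : op_adj z = z by rewrite op_adj_scale xx conjc_real.
have hz : op_norm_le z 2^-1.
  apply: op_norm_leW (op_norm_le_scale _ hx).
  rewrite normc_real gtr0_norm // /t invfM -mulrA mulVf ?mulr1 //.
  by rewrite gt_eqF.
have h1 := state_le1 uz zz hz.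
have h2 : - phi z <= 1.
  rewrite -state_opp //; apply: state_le1; first exact: uroe_opp.
    by rewrite !op_oppE op_adj_scale zz rmorphN rmorph1.
  exact: op_norm_le_opp.
have : normc (phi z) <= 1.
  (* In the order on complex numbers, [phi z <= 1] also says that [phi z] is real, so the two
     one-sided bounds control its modulus. *)
  suff : `|phi z| <= 1 by rewrite normr_normc -(rmorph1 (real_complex R)) lecR.
  by rewrite real_ler_norml ?(ler1_real h1) // lerNl h2 h1.
case: phiS => _ hZ _ _; rewrite /z hZ // Normc.normcM normc_real gtr0_norm //.
by rewrite /t mulrC ler_pdivrMr ?mul1r // mulr_gt0.
Qed.

Lemma state_bound c e : 0 < e -> uroe d c -> op_norm_le c e -> normc (phi c) <= 4 * e.
Proof.
move=> e0 uc hc; have uc' := uroe_adj dM uc; have hc' := op_norm_le_adj hc.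
pose I : R[i] := 0 +i* 1.
have II : I * I = -1.
  apply/eqP; rewrite eq_complex /=.
  by rewrite !(mul0r, mulr0, mul1r, addr0, sub0r, oppr0) !eqxx.
have nI : normc I = 1 := normc_i R.
pose x := op_add c (op_adj c); pose y := op_scale I (op_sub c (op_adj c)).
have ux : uroe d x by exact: uroe_add.
have us : uroe d (op_sub c (op_adj c)) by exact: uroe_sub.
have uy : uroe d y by exact: uroe_scale.
have xx : op_adj x = x by rewrite op_adj_add op_adjK /x; op_ring.
have yy : op_adj y = y.
  rewrite op_adj_scale op_adj_sub op_adjK.
  have -> : I^* = - I by apply/eqP; rewrite eq_complex /= oppr0 !eqxx.
  by rewrite /y; op_ring.
have e2 : 0 < e + e by rewrite addr_gt0.
have bx : normc (phi x) <= 2 * (e + e).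
  by apply: state_selfadj_bound => //; exact: op_norm_le_add.
have byy : normc (phi y) <= 2 * (e + e).
  apply: state_selfadj_bound => //; rewrite -[e + e]mul1r -nI.
  by apply: op_norm_le_scale; apply: op_norm_le_add => //; exact: op_norm_le_opp.
have cE : c = op_add (op_scale 2^-1 x) (op_scale (2^-1 * - I) y).
  apply/funext => p; apply/funext => q; rewrite /x /y /op_add /op_opp /op_scale.
  have -> : 2^-1 * - I * (I * (c p q - op_adj c p q)) =
    2^-1 * (- (I * I)) * (c p q - op_adj c p q) by ring.
  by rewrite II; field.
have -> : phi c = 2^-1 * phi x + (2^-1 * - I) * phi y.
  case: phiS => hD hZ _ _; rewrite [in LHS]cE hD ?hZ //; exact: uroe_scale.
apply: le_trans (normc_D _ _) _; rewrite !Normc.normcM normc_half normc_N nI.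
lra.
Qed.

End State.

(** * Colouring graphs of bounded degree *)

Section Colouring.
Variables (T : eqType) (e : T -> T -> Prop).
Hypotheses (e_refl : forall x, e x x) (e_sym : forall x y, e x y -> e y x).

(** Zorn's lemma: two points in the union of a chain lie in a common member, so independence passes
    to unions. A point of [A] with no neighbour in [M] could be added to [M]. *)
Lemma maximal_independent (A : set T) :
  exists M : set T, [/\ (M `<=` A)%classic,
    forall x y, M x -> M y -> e x y -> x = y &
    forall x, A x -> ~ M x -> exists2 y, M y & e x y].
Proof.
pose P (M : set T) := (M `<=` A)%classic /\ forall x y, M x -> M y -> e x y -> x = y.
have [F FP Ftot|M [[MA Mind] Mmax]] := @Zorn_bigcup T P.
  split=> [x [B FB Bx]|x y [B FB Bx] [C FC Cy]]; first by case: (FP _ FB) => + _; apply.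
  have [BC|CB] := Ftot _ _ FB FC.
    by case: (FP _ FC) => _; apply=> //; exact: BC.
  by case: (FP _ FB) => _; apply=> //; exact: CB.
exists M; split=> // x Ax Mx; apply: contrapT => noy.
apply: (Mmax (M `|` [set x])%classic).
  split; first exact: subsetUl.
  by move=> /(_ x (or_intror erefl)).
split=> [y [/MA //|->//]|y z [My|->] [Mz|->]] //; first exact: Mind.
- by move=> /e_sym eyx; case: noy; exists y.
- by move=> ezx; case: noy; exists z.
Qed.

(* Greedy colouring, one colour class at a time: removing a maximal
   e-independent set lowers the bound on the degrees by one. *)
Lemma bounded_degree_colouring (N : nat) (A : set T) :
  (forall x (s : seq T), A x -> uniq s -> (forall y, y \in s -> A y /\ e x y) ->
     (size s <= N)%N) ->
  exists col : T -> nat, (forall x, A x -> (col x < N)%N) /\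
    (forall x y, A x -> A y -> e x y -> col x = col y -> x = y).
Proof.
elim: N A => [|N ih] A degA.
  (* Each point is its own neighbour, so degree bound 0 forces [A] to be empty. *)
  have A0 x : ~ A x.
    move=> Ax; suff : (size [:: x] <= 0)%N by [].
    by apply: (degA x) => // y; rewrite inE => /eqP ->.
  by exists (fun=> 0%N); split=> [x /A0|x y /A0].
have [M [MA Mind Mdom]] := maximal_independent A.
have [|col [colN colA]] := ih (A `\` M)%classic.
  move=> x s [Ax Mx] us hs; have [y My exy] := Mdom x Ax Mx.
  (* The neighbour [y] lies in [M], hence outside [s], and prepending it uses up one unit of the
     degree bound. *)
  apply: (degA x (y :: s)) => //=.
    by rewrite us andbT; apply/negP => /hs[[]].
  by move=> z; rewrite inE => /predU1P[->|/hs[[]]//]; split=> //; exact: MA.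
exists (fun x => if `[< M x >] then N else col x); split=> [x Ax|x y Ax Ay exy].
  by case: asboolP => // Mx; apply: leqW; exact: colN.
case: asboolP => Mx; case: asboolP => My.
- by move=> _; exact: Mind.
- by move=> colE; have := colN y (conj Ay My); rewrite -colE ltnn.
- by move=> colE; have := colN x (conj Ax Mx); rewrite colE ltnn.
- exact: colA.
Qed.

End Colouring.

(** * The KMS condition against diagonal operators *)

Section KMS.
Variables (R : realType) (X : choiceType) (d : X -> X -> R).
Variables (h : X -> R) (beta : R) (phi : op R X -> R[i]).
Hypotheses (dM : is_metric d) (phiK : is_KMS d h beta phi).
Implicit Types (a b : op R X) (f : X -> R[i]) (M r : R).

(** On the diagonal the phase has exponent [h x - h x], so the orbit is constant and extends with
    derivative zero, written here as [op_scale 0 (op_diag f)]. *)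
Lemma analytic_ext_diag f M : 0 <= M -> (forall x, normc (f x) <= M) ->
  analytic_ext d h (op_diag f) (fun=> op_diag f).
Proof.
move=> M0 fM; split.
  split=> [_|_]; first exact: (uroe_diag dM M0).
  exists (op_scale 0 (op_diag f)) => e e0; exists 1; split=> // w _ _.
  have -> : op_sub (op_scale w^-1 (op_sub (op_diag f) (op_diag f)))
      (op_scale 0 (op_diag f)) = op_sub (op_diag f) (op_diag f) by op_ring.
  by apply: op_norm_leW (op_norm_le_subrr _); exact: ltW.
move=> t; apply/funext => x; apply/funext => y; rewrite /sigma /op_diag.
case: eqP => [->|_]; last by rewrite mulr0.
by rewrite subrr mulr0 /expi cos0 sin0 mulr0 addr0 mul1r.
Qed.

Lemma KMS_diag_comm f M a : 0 <= M -> (forall x, normc (f x) <= M) -> uroe d a ->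
  phi (op_mul a (op_diag f)) = phi (op_mul (op_diag f) a).
Proof.
move=> M0 fM ua; case: phiK => _ kms.
exact: kms ua (uroe_diag dM M0 fM) (analytic_ext_diag M0 fM).
Qed.

Lemma uroe_condexp a : bounded_op a -> uroe d (condexp a).
Proof.
move=> [M ha]; apply: (uroe_diag dM (op_norm_le_ge0 ha)) => x.
exact: op_norm_le_entry.
Qed.

Lemma condexp_add a b : condexp (op_add a b) = op_add (condexp a) (condexp b).
Proof.
apply/funext => x; apply/funext => y; rewrite /condexp /op_add.
by case: ifP; rewrite ?addr0.
Qed.

Lemma condexp_sub a b : condexp (op_sub a b) = op_sub (condexp a) (condexp b).
Proof.
rewrite condexp_add; congr op_add; apply/funext => x; apply/funext => y.
by rewrite /condexp /op_opp; case: ifP; rewrite ?oppr0.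
Qed.

(** The product p a, with p the projection onto the span of the basis vectors in [P]. *)
Definition op_rows (P : pred X) a : op R X := fun x y => if P x then a x y else 0.

Lemma op_rowsE P a :
  op_rows P a = op_mul (op_diag (fun x => if P x then 1 else 0)) a.
Proof.
rewrite op_mul_diagl; apply/funext => x; apply/funext => y; rewrite /op_rows.
by case: ifP; rewrite ?mul1r ?mul0r.
Qed.

Lemma normc_indicator (P : pred X) x : normc (if P x then 1 else 0 : R[i]) <= 1.
Proof. by case: ifP; rewrite ?Normc.normc1 ?Normc.normc0. Qed.

Lemma uroe_rows P a : uroe d a -> uroe d (op_rows P a).
Proof.
move=> ua; rewrite op_rowsE; apply: uroe_mul => //.
by apply: (uroe_diag dM (@ler01 R)) => x; exact: normc_indicator.
Qed.

Lemma KMS_rows_condexp (P : pred X) a : uroe d a ->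
  (forall x y, P x -> P y -> a x y != 0 -> x = y) ->
  phi (op_rows P a) = phi (condexp (op_rows P a)).
Proof.
move=> ua sepP.
(* Idempotence of the projection supplies a second copy, which the KMS condition moves to the right;
   the resulting compression is diagonal by [sepP]. *)
have -> : op_rows P a = op_rows P (op_rows P a).
  by apply/funext => x; apply/funext => y; rewrite /op_rows; case: (P x).
rewrite {1}op_rowsE -(KMS_diag_comm (@ler01 R)); first last.
- exact: uroe_rows.
- by move=> x; exact: normc_indicator.
rewrite op_mul_diagr; congr phi; apply/funext => x; apply/funext => y.
rewrite /condexp /op_rows; case: eqP => [->|xy]; first by case: ifP; rewrite ?mulr1 ?mul0r.
case: ifP => Px; last by rewrite mul0r.
case: ifP => Py; last by rewrite mulr0.
by rewrite mulr1; apply/eqP; apply: contrapT => /negP /(sepP _ _ Px Py).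
Qed.

Lemma KMS_roe_condexp a : ulf d -> roe_alg d a -> phi a = phi (condexp a).
Proof.
move=> dU ra; have ua := roe_uroe ra; have [_ [r0 ar0]] := ra.
(* [ulf] speaks of positive radii only, whereas [r0] may be zero or negative. *)
pose r := Num.max r0 1.
have r_gt0 : 0 < r by rewrite lt_max ltr01 orbT.
have ar : prop_le d a r by apply: prop_leW ar0; rewrite le_max lexx.
have [N degN] := dU r r_gt0.
have [d_ge0 d0 dC _] := dM.
have [x|x y||col [colN col_inj]] :=
    @bounded_degree_colouring X (fun x y => d x y <= r) _ _ N setT.
- by rewrite ((d0 x x).2 erefl) ltW.
- by rewrite dC.
- move=> x s _ us hs; apply: (degN x) => //; apply/allP => y ys.
  by have [] := hs y ys.
suff key k : phi (op_rows (fun x => (col x < k)%N) a) =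
    phi (condexp (op_rows (fun x => (col x < k)%N) a)).
  have aE : a = op_rows (fun x => (col x < N)%N) a.
    by apply/funext => x; apply/funext => y; rewrite /op_rows colN.
  by rewrite aE; exact: key.
have [[phiD _ _ _] _] := phiK.
elim: k => [|k ih].
  by congr phi; apply/funext => x; apply/funext => y; rewrite /condexp; case: ifP.
have -> : op_rows (fun x => (col x < k.+1)%N) a =
    op_add (op_rows (fun x => (col x < k)%N) a) (op_rows (fun x => col x == k) a).
  apply/funext => x; apply/funext => y; rewrite /op_rows /op_add ltnS.
  by case: ltngtP; rewrite ?addr0 ?add0r.
have u1 := uroe_rows (fun x => (col x < k)%N) ua.
have u2 := uroe_rows (fun x => col x == k) ua.
have [u3 u4] := (uroe_condexp (uroe_bounded u1), uroe_condexp (uroe_bounded u2)).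
rewrite condexp_add !phiD //.
rewrite ih; congr (_ + _); apply: KMS_rows_condexp => // x y /eqP cx /eqP cy axy.
by apply: col_inj => //; [exact: ar | rewrite cx cy].
Qed.

End KMS.

(** * From finite propagation to the whole algebra by density *)

Theorem theorem1p5 (R : realType) (X : choiceType) (d : X -> X -> R)
  (h : X -> R) (beta : R) (phi : op R X -> R[i]) :
  is_metric d -> ulf d -> coarse d h -> is_KMS d h beta phi ->
  forall a : op R X, uroe d a -> phi a = phi (condexp a).
Proof.
move=> dM dU _ phiK a ua; have [phiS _] := phiK.
apply/eqP; rewrite -subr_eq0; apply/eqP; apply: normc_le_eps => e e0.
(* [state_bound] loses a factor 4 and is used twice: 2 * 4 * (e / 8) = e. *)
have e8 : 0 < e / 8 by rewrite divr_gt0.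
have [_ /(_ _ e8)[b [rb hab]]] := ua.
have ub := roe_uroe rb.
have uE := uroe_condexp dM (uroe_bounded ua).
have uEb := uroe_condexp dM (uroe_bounded ub).
(* The expectation is contractive, because each entry is bounded by the operator norm. *)
have hE : op_norm_le (op_sub (condexp a) (condexp b)) (e / 8).
  rewrite -condexp_sub; apply: op_norm_le_diag; first exact: ltW.
  by move=> x; exact: op_norm_le_entry.
have h1 := state_bound dM phiS e8 (uroe_sub ua ub) hab.
have h2 := state_bound dM phiS e8 (uroe_sub uE uEb) hE.
(* Since [phi b = phi (condexp b)], both estimates share the middle term [phi (condexp b)]. *)
move: h1 h2; rewrite !(state_sub phiS) // (KMS_roe_condexp dM phiK dU rb) => h1 h2.
have -> : phi a - phi (condexp a) =
    (phi a - phi (condexp b)) - (phi (condexp a) - phi (condexp b)) by ring.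
apply: le_trans (normc_D _ _) _; rewrite normc_N; lra.
Qed.
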